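(* Let $\mathfrak{g}$ be a simple Lie $2$-algebra over $\mathbb{F}$ of toral rank $MT(\mathfrak{g})=3$, and let $\mathfrak{t}$ be a maximal torus of $\mathfrak{g}$ with $\dim\mathfrak{t}=3$ whose associated Cartan subalgebra $\mathfrak{h}=\mathfrak{c}_{\mathfrak{g}}(\mathfrak{t})$ is triangulable. Let $\{t_1,t_2,t_3\}$ be a basis of $\mathfrak{t}$ consisting of toral elements, with dual basis $\alpha,\beta,\gamma$ of $\mathfrak{t}^*$. Then $\dim(\mathfrak{g}_{\xi})=\dim(\mathfrak{g}_{\sigma})$ for any two elements $\xi,\sigma$ of $\{\alpha,\beta,\gamma,\alpha+\beta,\alpha+\gamma,\beta+\gamma,\alpha+\beta+\gamma\}$.
   Context: $\mathbb{F}$ is an algebraically closed field of characteristic $2$; all Lie algebras are finite-dimensional over $\mathbb{F}$. A Lie $2$-algebra is a Lie algebra $\mathfrak{g}$ with a map $[2]:\mathfrak{g}\to\mathfrak{g}$, $a\mapsto a^{[2]}$, such that $(\lambda a)^{[2]}=\lambda^2a^{[2]}$, $\operatorname{ad}(a)^2=\operatorname{ad}(a^{[2]})$ and $(a+b)^{[2]}=a^{[2]}+b^{[2]}+[a,b]$ for all $\lambda\in\mathbb{F}$, $a,b\in\mathfrak{g}$. It is simple if $\dim\mathfrak{g}\neq 1$ and it has no nonzero proper ideals. A $2$-subalgebra is a subalgebra closed under $[2]$. A torus is an (abelian) $2$-subalgebra on which the $2$-map is invertible; a torus is maximal if it is not properly contained in another torus. A toral element is an $x$ with $x^{[2]}=x$;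 every torus has a basis of toral elements. The toral rank $MT(\mathfrak{g})$ is the maximum of the dimensions of tori of $\mathfrak{g}$. For a maximal torus $\mathfrak{t}$, the centralizer $\mathfrak{h}=\mathfrak{c}_{\mathfrak{g}}(\mathfrak{t})$ is a Cartan subalgebra; it is triangulable if $[\mathfrak{h},\mathfrak{h}]$ acts nilpotently on $\mathfrak{g}$ (equivalently, the set $\mathfrak{n}$ of $2$-nilpotent elements of $\mathfrak{h}$, i.e. those $x$ annihilated by some iterate of the $2$-map, is an ideal of $\mathfrak{h}$; then $\mathfrak{h}=\mathfrak{t}\oplus\mathfrak{n}$). For $\lambda\in\mathfrak{t}^*$, $\mathfrak{g}_\lambda=\{v\in\mathfrak{g}\mid [t,v]=\lambda(t)v\ \text{for all } t\in\mathfrak{t}\}$ (possibly zero). *)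

(* Defs.v *)
From HB Require Import structures.
From mathcomp Require Import all_boot all_algebra.

Set Implicit Arguments.
Unset Strict Implicit.
Unset Printing Implicit Defensive.

Import GRing.Theory.
Local Open Scope ring_scope.

HB.mixin Record Vector_isLieAlgebra (F : fieldType) L of Vector F L := {
  lie : L -> L -> L;
  lie_linearl : forall y : L, linear (fun x => lie x y);
  lie_linearr : forall x : L, linear (lie x);
  lie_alt : forall x : L, lie x x = 0;
  lie_jacobi : forall x y z : L,
    lie x (lie y z) + lie y (lie z x) + lie z (lie x y) = 0
}.

#[short(type="lieAlgType")]
HB.structure Definition LieAlgebra (F : fieldType) :=
  {L of Vector F L & Vector_isLieAlgebra F L}.

(* [p2map x] is x^[2]. The axioms are meant for F of characteristic 2, which  *)
(* is a separate hypothesis wherever it is needed.                            *)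
HB.mixin Record LieAlgebra_isLie2 (F : fieldType) L of LieAlgebra F L := {
  p2map : L -> L;
  p2mapZ : forall (a : F) (x : L), p2map (a *: x) = a ^+ 2 *: p2map x;
  p2map_ad : forall x y : L, lie x (lie x y) = lie (p2map x) y;
  p2mapD : forall x y : L, p2map (x + y) = p2map x + p2map y + lie x y
}.

#[short(type="lie2AlgType")]
HB.structure Definition Lie2Algebra (F : fieldType) :=
  {L of LieAlgebra F L & LieAlgebra_isLie2 F L}.

HB.instance Definition _ (F : fieldType) (L : lieAlgType F) (x : L) :=
  GRing.isLinear.Build F L L *:%R (lie x) (lie_linearr x).

Definition ad (F : fieldType) (L : lieAlgType F) (x : L) : 'End(L) :=
  linfun (lie x).

Lemma adE (F : fieldType) (L : lieAlgType F) (x y : L) : ad x y = lie x y.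
Proof. exact: lfunE. Qed.

Section LieNotions.
Variables (F : fieldType) (L : lieAlgType F).
Implicit Types (U I : {vspace L}) (x : L).

Definition lie_subalgebra U := {in U &, forall x y, lie x y \in U}.

Definition lie_ideal I := forall x y : L, y \in I -> lie x y \in I.

Definition lie_simple :=
  \dim {:L} <> 1%N /\ (forall I, lie_ideal I -> I = 0%VS \/ I = fullv).

Definition lie_abelian U := {in U &, forall x y, lie x y = 0}.

(* Brackets of basis vectors suffice by bilinearity, as in the definition of  *)
(* [prodv]; see [mem_derivedv] and [derivedv_sub].                            *)
Definition derivedv U : {vspace L} :=
  <<[seq lie x y | x <- vbasis U, y <- vbasis U]>>%VS.

(* See [mem_centralizerv]. *)
Definition centralizerv U : {vspace L} :=
  (\bigcap_(i < \dim U) lker (ad (vbasis U)`_i))%VS.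

Definition ad_nilpotent x := exists n : nat, forall y : L, iter n (lie x) y = 0.

Definition triangulable U := {in derivedv U, forall x, ad_nilpotent x}.

(* See [mem_weightv]. *)
Definition weightv U (lambda : 'Hom(subvs_of U, F^o)) : {vspace L} :=
  (\bigcap_(i < \dim {:subvs_of U})
     lker (ad (vsval (vbasis {:subvs_of U})`_i)
           - (lambda (vbasis {:subvs_of U})`_i : F) *: \1%VF))%VS.

Lemma lieDl (x y z : L) : lie (x + y) z = lie x z + lie y z.
Proof. by have := lie_linearl z 1 x y; rewrite !scale1r. Qed.

Lemma lie0l (z : L) : lie 0 z = 0.
Proof. by apply: (addrI (lie 0 z)); rewrite -lieDl !addr0. Qed.

Lemma lieZl (a : F) (x z : L) : lie (a *: x) z = a *: lie x z.
Proof. by have := lie_linearl z a x 0; rewrite lie0l !addr0. Qed.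

Lemma lie_suml (n : nat) (f : 'I_n -> L) (z : L) :
  lie (\sum_i f i) z = \sum_i lie (f i) z.
Proof.
by apply: (big_morph (fun x => lie x z)) => [x y|]; rewrite ?lie0l ?lieDl.
Qed.

Lemma mem_derivedv U : {in U &, forall x y, lie x y \in derivedv U}.
Proof.
move=> x y /coord_vbasis-> /coord_vbasis->.
rewrite lie_suml memv_suml // => i _; rewrite linear_sum memv_suml // => j _.
rewrite linearZ /= lieZl !memvZ // memv_span //.
by apply: allpairs_f; apply: mem_nth; rewrite size_tuple.
Qed.

Lemma derivedv_sub U (V : {vspace L}) :
  {in U &, forall x y, lie x y \in V} -> (derivedv U <= V)%VS.
Proof.
move=> UV; apply/span_subvP => _ /allpairsP[[x y] /= [xU yU ->]].
by apply: UV; apply: vbasis_mem.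
Qed.

Lemma mem_centralizerv U x :
  x \in centralizerv U <-> {in U, forall u, lie u x = 0}.
Proof.
split=> [xC u /coord_vbasis-> | xC].
  rewrite lie_suml big1 // => i _; rewrite lieZl -adE.
  suff /eqP->: ad (vbasis U)`_i x == 0 by rewrite scaler0.
  by rewrite -memv_ker; move/subv_bigcapP: xC; apply.
apply/subv_bigcapP => i _; rewrite -memvE memv_ker adE xC //.
by apply: vbasis_mem; apply: mem_nth; rewrite size_tuple.
Qed.

Lemma mem_weightv U (lambda : 'Hom(subvs_of U, F^o)) x :
  x \in weightv lambda <->
  (forall u : subvs_of U, lie (vsval u) x = (lambda u : F) *: x).
Proof.
split=> [xW u | xW].
  rewrite (coord_vbasis (memvf u)) !linear_sum lie_suml scaler_suml.
  apply: eq_bigr => i _; rewrite !linearZ /= lieZl -adE -scalerA.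
  congr (_ *: _); apply/eqP; rewrite -subr_eq0.
  suff: x \in lker (ad (vsval (vbasis {:subvs_of U})`_i)
           - (lambda (vbasis {:subvs_of U})`_i : F) *: \1%VF).
    by rewrite memv_ker add_lfunE opp_lfunE scale_lfunE id_lfunE.
  by have /subv_bigcapP/(_ i isT) := xW.
apply/subv_bigcapP => i _; rewrite -memvE memv_ker.
by rewrite add_lfunE opp_lfunE scale_lfunE id_lfunE adE xW subrr.
Qed.

End LieNotions.

Section Lie2Notions.
Variables (F : fieldType) (L : lie2AlgType F).
Implicit Types (T : {vspace L}) (x : L).

Definition lie2_subalgebra T :=
  lie_subalgebra T /\ {in T, forall x, p2map x \in T}.

Definition p2map_invertible T :=
  exists f : L -> L,
    [/\ {in T, forall x, f x \in T},
        {in T, cancel p2map f} & {in T, cancel f p2map}].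

Definition torus T :=
  [/\ lie2_subalgebra T, lie_abelian T & p2map_invertible T].

Definition maximal_torus T :=
  torus T /\ (forall S, torus S -> (T <= S)%VS -> S = T).

Definition toral x := p2map x = x.

End Lie2Notions.

(* [toral_rank_spec L n] says that MT(L) = n. *)
Definition toral_rank_spec (F : fieldType) (L : lie2AlgType F) (n : nat) :=
  (exists2 T : {vspace L}, torus T & \dim T = n) /\
  (forall T : {vspace L}, torus T -> (\dim T <= n)%N).

(* [f] is the dual basis of [X], for [X] a basis of V.                        *)
Definition dual_basis (F : fieldType) (V : vectType F) (n : nat)
    (X : n.-tuple V) (f : n.-tuple 'Hom(V, F^o)) :=
  forall i j : 'I_n, tnth f i (tnth X j) = (i == j)%:R :> F.

(* Main.v *)
Require Import Defs.
From HB Require Import structures.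
From mathcomp Require Import all_boot all_algebra.

(* For x of weight e the square x^[2] lies in h; write s(x) in t for its      *)
(* toral part (h = t + n). If xi(s(x)) <> 0 then ad(x)^2 = ad(x^[2]) is       *)
(* invertible on g_xi, and on g_(xi+e) because e(s(x)) = 0, so the two weight *)
(* spaces have the same dimension. Let T_e be the span of the s(x) for x of   *)
(* weight e. For a nonzero toral u in t, the image of ad(u) generates g as an *)
(* ideal, and the weight 0 part of this ideal is spanned by brackets [x, y] = *)
(* (x + y)^[2] - x^[2] - y^[2] with x, y of a common weight e such that e(u)  *)
(* = 1; hence the T_e with e(u) = 1 span t. These spanning conditions connect *)
(* all seven weights through pairs {xi, xi + e} with xi(T_e) <> 0: a finite   *)
(* check over the 2-colourings of the Fano plane. Additivity of s comes from  *)
(* an Engel argument: a sum of two ad-nilpotent elements of the triangulable  *)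
(* algebra h is ad-nilpotent.                                                 *)

(** Four lemmas carry this argument. [jordan_maximal_torus] produces the toral part of an element of
    the centralizer of [t]. [weight_null_dim] says that a change of dimension from [mu] to
    [mu + lambda] forces [mu] to vanish on the toral parts of squares of weight [lambda].
    [not_all_weight_null] is the spanning property of these toral parts, read dually.
    [fano_constant] shows by computation that the last two facts leave no room for a nonconstant
    colouring of the seven weights, and [dim_weight_of] applies it to the colouring by dimension. *)

Set Implicit Arguments.
Unset Strict Implicit.
Unset Printing Implicit Defensive.

Import GRing.Theory.
Local Open Scope ring_scope.

(** * Engel's theorem *)

Section Bracket.
Variables (F : fieldType) (L : lieAlgType F).
Implicit Types (K M U V : {vspace L}) (x y z : L).

Lemma lieC x y : lie x y = - lie y x.
Proof.
apply/eqP; rewrite -addr_eq0; apply/eqP.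
have := lie_alt (x + y); rewrite lieDl !linearD /= !lie_alt add0r addr0.
by [].
Qed.

Lemma lie_leibniz x y z : lie x (lie y z) = lie (lie x y) z + lie y (lie x z).
Proof.
have := lie_jacobi x y z; rewrite (lieC z (lie x y)) (lieC z x) linearN /=.
by move/eqP; rewrite -addrA -opprD subr_eq0 => /eqP->; rewrite addrC.
Qed.

Lemma lie0r x : lie x 0 = 0.
Proof. exact: linear0. Qed.

Lemma lie_swap x y : lie x y = 0 -> lie y x = 0.
Proof. by move=> xy; rewrite lieC xy oppr0. Qed.

Lemma centralizervP U x :
  reflect {in U, forall u, lie u x = 0} (x \in centralizerv U).
Proof. by apply: (iffP idP) => /mem_centralizerv. Qed.

Lemma centralizer_subalgebra U : lie_subalgebra (centralizerv U).
Proof.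
move=> x y /centralizervP xC /centralizervP yC; apply/centralizervP => u uU.
by rewrite lie_leibniz (xC u) // (yC u) // lie0l lie0r addr0.
Qed.

Lemma iter_lie0 x n : iter n (lie x) 0 = 0.
Proof. by elim: n => //= n ->; rewrite lie0r. Qed.

Lemma ad_nilpotentZ a x : ad_nilpotent x -> ad_nilpotent (a *: x).
Proof.
case=> n xn; exists n => y.
suff ->: iter n (lie (a *: x)) y = a ^+ n *: iter n (lie x) y.
  by rewrite xn scaler0.
elim: n {xn} => [|n IHn] /=; first by rewrite scale1r.
by rewrite IHn lieZl linearZ /= scalerA exprS.
Qed.

Lemma ad_nilpotent_eigenvalue x y a :
  ad_nilpotent x -> lie x y = a *: y -> y != 0 -> a = 0.
Proof.
case=> n xn xy y0.
have /eqP : iter n (lie x) y = a ^+ n *: y.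
  elim: n {xn} => [|n IHn] /=; first by rewrite scale1r.
  by rewrite IHn linearZ /= xy scalerA -exprSr.
by rewrite xn eq_sym scaler_eq0 (negPf y0) orbF expf_eq0 => /andP[_ /eqP].
Qed.

Definition lie_stable K V := forall x v, x \in K -> v \in V -> lie x v \in V.

(* The conclusion of Engel's theorem, stated on subquotients [V1 / V0] so     *)
(* that it also applies to the action of a subalgebra [M] of [K] on [K / M].  *)
Definition engel K := forall V0 V1 : {vspace L},
  (V0 <= V1)%VS -> ~~ (V1 <= V0)%VS -> lie_stable K V0 -> lie_stable K V1 ->
  exists v, [/\ v \in V1, v \notin V0 & forall x, x \in K -> lie x v \in V0].

Lemma engel0 : engel 0%VS.
Proof.
move=> V0 V1 _ /subvPn[v v1 v0] _ _; exists v; split=> // x.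
by rewrite memv0 => /eqP->; rewrite lie0l mem0v.
Qed.

(** Since [x] normalizes [M], every iterate of [ad x] on a vector killed by [M] modulo [V0] is again
    killed by [M] modulo [V0]. The last iterate outside [V0] is then also killed by [x]. *)
Lemma engel_add_line M x :
  engel M -> ad_nilpotent x -> {in M, forall m, lie m x \in M} ->
  engel (M + <[x]>)%VS.
Proof.
move=> engM [n xn] Mx V0 V1 V01 V10 st0 st1.
have xMx : x \in (M + <[x]>)%VS by apply: subvP (addvSr _ _) _ (memv_line _).
have sM y : y \in M -> y \in (M + <[x]>)%VS by apply/subvP: y; apply: addvSl.
have [||v [v1 v0 Mv]] := engM V0 V1 V01 V10.
- by move=> y w yM; apply: st0; apply: sM.
- by move=> y w yM; apply: st1; apply: sM.
have Mit k m : m \in M -> lie m (iter k (lie x) v) \in V0.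
  elim: k m => [|k IHk] m mM /=; first exact: Mv.
  by rewrite lie_leibniz rpredD //; [apply/IHk/Mx | apply/st0/IHk].
have it1 k : iter k (lie x) v \in V1 by elim: k => //= k; apply: st1.
have ex_k : exists k, iter k (lie x) v \in V0 by exists n; rewrite xn mem0v.
case: (ex_minnP ex_k) => -[|k]; first by rewrite /= (negPf v0).
move=> /= xk0 k_min; exists (iter k (lie x) v); split; first exact: it1.
  by apply/negP => /k_min; rewrite ltnn.
move=> z /memv_addP[m mM [w /vlineP[a ->] ->]].
by rewrite lieDl lieZl rpredD ?rpredZ //; apply: Mit.
Qed.

(** A subalgebra [M] satisfying [engel] is enlarged until it fills [K]. *)
Lemma nilpotent_engel K :
  lie_subalgebra K -> {in K, forall x, ad_nilpotent x} -> engel K.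
Proof.
move=> Ksub Knil.
suff ext n M : (\dim K - \dim M <= n)%N -> (M <= K)%VS -> lie_subalgebra M ->
    engel M -> engel K.
  apply: (ext _ 0%VS (leqnn _) (sub0v _) _ engel0).
  by move=> x y _; rewrite !memv0 => /eqP->; rewrite lie0r.
elim: n M => [|n IHn] M dimM MK Msub engM.
  suff -> : K = M by [].
  by apply/esym/eqP; rewrite eqEdim MK -subn_eq0 -leqn0.
have [KM | KM] := boolP (K <= M)%VS.
  by have <- : M = K by apply/eqP; rewrite eqEsubv MK.
(* Acting on the quotient of [K] by [M], [M] kills some nonzero class: its representative normalizes
   [M]. *)
have [||x [xK xM Mx]] := engM M K MK KM.
- by move=> y z; apply: Msub.
- by move=> y z /(subvP MK) yK; apply: Ksub.
apply: (IHn (M + <[x]>)%VS); last exact: engel_add_line engM (Knil _ xK) Mx.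
- have ltM : (\dim M < \dim (M + <[x]>)%VS)%N.
    rewrite ltn_neqAle dimvS ?addvSl // andbT; apply/negP => dimE.
    move: xM; suff -> : M = (M + <[x]>)%VS.
      by rewrite (subvP (addvSr _ _) _ (memv_line _)).
    by apply/eqP; rewrite eqEdim addvSl (eqP dimE) /=.
  by rewrite -ltnS (leq_trans _ dimM) // ltn_sub2l //
     (leq_trans ltM) // dimvS // subv_add MK -memvE.
- by rewrite subv_add MK -memvE.
move=> z z' /memv_addP[m mM [w /vlineP[a ->] ->]].
move=> /memv_addP[m' mM' [w' /vlineP[b ->] ->]].
apply: subvP (addvSl _ _) _ _.
rewrite lieDl lieZl !linearD !linearZ /= lie_alt (lieC x m') !scaler0 addr0.
by rewrite !(rpredD, rpredN, rpredZ) ?Mx ?Msub.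
Qed.

(** Repeated use of [engel] builds a flag from 0 to the whole space, each step one line larger,
    along which every element of [K] maps each term into the previous one. *)
Lemma engel_nilpotent K : engel K -> {in K, forall x, ad_nilpotent x}.
Proof.
move=> engK x xK.
suff ext n V : (\dim {:L} - \dim V <= n)%N -> lie_stable K V ->
    (exists m, {in V, forall v, iter m (lie x) v = 0}) -> ad_nilpotent x.
  apply: (ext _ 0%VS (leqnn _)).
    by move=> y v _; rewrite memv0 => /eqP->; rewrite lie0r mem0v.
  by exists 0%N => v; rewrite memv0 => /eqP.
elim: n V => [|n IHn] V dimV stV [m Vm].
  have Vfull : V = fullv by apply/eqP; rewrite eqEdim subvf -subn_eq0 -leqn0.
  by exists m => y; rewrite Vm // Vfull memvf.
have [fV | fV] := boolP (fullv <= V)%VS.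
  by exists m => y; rewrite Vm // (subvP fV) ?memvf.
have [|v [_ vV Kv]] := engK V fullv (subvf _) fV stV.
  by move=> *; rewrite memvf.
have ltV : (\dim V < \dim (V + <[v]>)%VS)%N.
  rewrite ltn_neqAle dimvS ?addvSl // andbT; apply/negP => dimE.
  move: vV; suff -> : V = (V + <[v]>)%VS.
    by rewrite (subvP (addvSr _ _) _ (memv_line _)).
  by apply/eqP; rewrite eqEdim addvSl (eqP dimE) /=.
apply: (IHn (V + <[v]>)%VS).
- by rewrite -ltnS (leq_trans _ dimV) // ltn_sub2l //
     (leq_trans ltV) // dimvS // subvf.
- move=> y z yK /memv_addP[w wV [w' /vlineP[a ->] ->]].
  apply: subvP (addvSl _ _) _ _; rewrite linearD linearZ /=.
  by rewrite rpredD ?rpredZ ?Kv ?stV.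
exists m.+1 => z /memv_addP[w wV [w' /vlineP[a ->] ->]].
by rewrite iterSr Vm // linearD linearZ /= rpredD ?rpredZ ?Kv ?stV.
Qed.

(** All brackets of elements of [U] fall in the derived algebra [D], which satisfies [engel]. Hence
    the lines of [x] and [y] can be added to [D] one after the other, and [x + y] lies in the
    result. *)
Lemma triangulable_nilpotentD U x y :
  lie_subalgebra U -> triangulable U -> x \in U -> y \in U ->
  ad_nilpotent x -> ad_nilpotent y -> ad_nilpotent (x + y).
Proof.
move=> Usub Unil xU yU xn yn.
set D := derivedv U.
have DU : (D <= U)%VS by apply: derivedv_sub.
have engD : engel D.
  apply: nilpotent_engel Unil => a b /(subvP DU) aU /(subvP DU) bU.
  exact: mem_derivedv.
have engDx := engel_add_line engD xn.
apply: (engel_nilpotent (engel_add_line (engDx _) yn _)).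
- by move=> m /(subvP DU) mU; apply: mem_derivedv.
- move=> z /memv_addP[m /(subvP DU) mU [w /vlineP[a ->] ->]].
  apply: subvP (addvSl _ _) _ _.
  by apply: mem_derivedv; rewrite ?rpredD ?rpredZ.
apply: memv_add (memv_line _).
exact: subvP (addvSr _ _) _ (memv_line _).
Qed.

End Bracket.

(** * Maximal tori and Jordan decompositions *)

Section Lie2.
Variables (F : fieldType) (g : lie2AlgType F).
Implicit Types (A U : {vspace g}) (x y z : g).

Lemma p2map0 : p2map (0 : g) = 0.
Proof. by have := p2mapZ 0 (0 : g); rewrite expr0n !scale0r. Qed.

Lemma p2mapD_comm x y : lie x y = 0 -> p2map (x + y) = p2map x + p2map y.
Proof. by move=> xy; rewrite p2mapD xy addr0. Qed.

Lemma p2map_comm x y : lie x y = 0 -> lie (p2map x) y = 0.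
Proof. by move=> xy; rewrite -p2map_ad xy lie0r. Qed.

Lemma iter_p2map_comm k x y : lie x y = 0 -> lie (iter k p2map x) y = 0.
Proof. by move=> xy; elim: k => //= k /p2map_comm. Qed.

Lemma iter_p2mapD k x y : lie x y = 0 ->
  iter k p2map (x + y) = iter k p2map x + iter k p2map y.
Proof.
move=> xy; elim: k => //= k ->; rewrite p2mapD_comm //.
by apply: iter_p2map_comm; apply: lie_swap; apply/iter_p2map_comm/lie_swap.
Qed.

Lemma iter_p2map_ad k x y : iter (2 ^ k) (lie x) y = lie (iter k p2map x) y.
Proof.
elim: k x y => //= k IHk x y.
by rewrite expnS mul2n -addnn iterD !IHk p2map_ad.
Qed.

Lemma p2map_sum_comm I (r : seq I) (f : I -> g) :
  (forall i j, lie (f i) (f j) = 0) ->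
  p2map (\sum_(i <- r) f i) = \sum_(i <- r) p2map (f i).
Proof.
move=> ff; elim: r => [|i r IHr]; first by rewrite !big_nil p2map0.
rewrite !big_cons p2mapD_comm ?IHr //.
by rewrite linear_sum big1 // => j _ /=.
Qed.

Lemma centralizer_p2map U x :
  x \in centralizerv U -> p2map x \in centralizerv U.
Proof.
move=> /centralizervP xC; apply/centralizervP => u uU.
by apply: lie_swap; apply: p2map_comm; apply: lie_swap; apply: xC.
Qed.

(** The double centralizer works: as [U] lies in its own centralizer, the double centralizer does
    too, hence is abelian; and every centralizer is closed under the 2-map. *)
Lemma abelian_envelope U : lie_abelian U ->
  exists A, [/\ (U <= A)%VS, lie_abelian A & {in A, forall x, p2map x \in A}].
Proof.
move=> Uab; exists (centralizerv (centralizerv U)).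
have UC : (U <= centralizerv U)%VS.
  by apply/subvP => x xU; apply/centralizervP => u uU; apply: Uab.
have CC : (centralizerv (centralizerv U) <= centralizerv U)%VS.
  apply/subvP => x /centralizervP xC; apply/centralizervP => u uU.
  by apply: xC; apply: (subvP UC).
split; last exact: centralizer_p2map.
  apply/subvP => x xU; apply/centralizervP => u /centralizervP uC.
  by apply: lie_swap; apply: uC.
by move=> x y /(subvP CC) xC /centralizervP; apply.
Qed.

(** For abelian [A] the 2-map is additive and semilinear for Frobenius, so the squares of a basis
    span all squares. *)
Definition p2span A : {vspace g} := <<[seq p2map x | x <- vbasis A]>>%VS.

Lemma vbasisi_mem A (i : 'I_(\dim A)) : (vbasis A)`_i \in A.
Proof. by apply: vbasis_mem; apply: mem_nth; rewrite size_tuple. Qed.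

Lemma p2map_abelian_sum A (c : 'I_(\dim A) -> F) : lie_abelian A ->
  p2map (\sum_i c i *: (vbasis A)`_i) = \sum_i c i ^+ 2 *: p2map (vbasis A)`_i.
Proof.
move=> Aab; rewrite p2map_sum_comm => [|i j].
  by apply: eq_bigr => i _; rewrite p2mapZ.
by rewrite Aab ?rpredZ ?vbasisi_mem.
Qed.

Lemma mem_p2span A : lie_abelian A -> {in A, forall x, p2map x \in p2span A}.
Proof.
move=> Aab x xA; rewrite (coord_vbasis xA) p2map_abelian_sum //.
apply: rpred_sum => i _; rewrite rpredZ // memv_span // map_f //.
by rewrite mem_nth // size_tuple.
Qed.

Lemma p2span_sub A : {in A, forall x, p2map x \in A} -> (p2span A <= A)%VS.
Proof.
by move=> Ap; apply/span_subvP => _ /mapP[x /vbasis_mem xA ->]; apply: Ap.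
Qed.

End Lie2.

Section Closed.
Variables (F : closedFieldType) (charF2 : 2%N \in [pchar F]).
Variable g : lie2AlgType F.
Implicit Types (A U T : {vspace g}) (x y z : g).

Lemma oppv_char2 x : - x = x.
Proof. by rewrite -[x]scale1r -scaleNr oppr_pchar2. Qed.

Lemma addvv_char2 x : x + x = 0.
Proof. by rewrite -{1}(oppv_char2 x) addNr. Qed.

Lemma sqrt_exists (a : F) : exists b, b ^+ 2 == a.
Proof.
have [b] := @solve_monicpoly F 2 (fun i => if i == 0%N then a else 0) isT.
rewrite !big_ord_recl big_ord0 /= expr0 mulr1 mul0r !addr0 => /eqP.
by exists b.
Qed.

Definition csqrt (a : F) : F := xchoose (sqrt_exists a).

Lemma csqrtK a : csqrt a ^+ 2 = a.
Proof. exact: eqP (xchooseP (sqrt_exists a)). Qed.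

Lemma csqrt_sqr a : csqrt (a ^+ 2) = a.
Proof.
have /eqP := csqrtK (a ^+ 2); rewrite eqf_sqr => /orP[|] /eqP-> //.
by rewrite oppr_pchar2.
Qed.

(** The squares of a basis are as many as the dimension, so they form a basis too. The inverse of
    the 2-map takes coordinates in it and extracts their square roots. *)
Lemma torus_p2span A : lie_abelian A -> {in A, forall x, p2map x \in A} ->
  (A <= p2span A)%VS -> torus A.
Proof.
move=> Aab Ap Aspan; split=> //.
  by split=> // x y xA yA; rewrite Aab ?mem0v.
have sz : size [seq p2map x | x <- vbasis A] == \dim A.
  by rewrite size_map size_tuple.
pose q := Tuple sz.
have qbasis : basis_of A q.
  rewrite /basis_of eqEsubv p2span_sub // Aspan /=.
  rewrite /free size_tuple eqn_leq (leq_trans (dim_span _)) ?size_tuple //=.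
  exact: dimvS.
have qE i : q`_i = p2map (vbasis A)`_i.
  have [iA | Ai] := ltnP i (\dim A).
    by rewrite /q /= (nth_map 0) // size_tuple.
  by rewrite !nth_default ?p2map0 // ?size_tuple.
exists (fun x => \sum_i csqrt (coord q i x) *: (vbasis A)`_i); split.
- by move=> x xA; rewrite rpred_sum // => i _; rewrite rpredZ ?vbasisi_mem.
- move=> x xA; rewrite {1}(coord_vbasis xA) p2map_abelian_sum //.
  rewrite [RHS](coord_vbasis xA); apply: eq_bigr => i _; congr (_ *: _).
  under eq_bigr => j _ do rewrite -qE.
  by rewrite coord_sum_free ?(basis_free qbasis) ?csqrt_sqr.
move=> x xA; rewrite p2map_abelian_sum // [RHS](coord_basis qbasis xA).
by apply: eq_bigr => i _; rewrite csqrtK qE.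
Qed.

(** Passing from [A] to [p2span A] keeps [T] inside, because the 2-map is onto on [T]. Once the
    dimension stops dropping, [A] is a torus, hence equal to [T]. *)
Lemma iter_p2map_maximal_torus T A : maximal_torus T -> (T <= A)%VS ->
  lie_abelian A -> {in A, forall x, p2map x \in A} ->
  {in A, forall x, exists k, iter k p2map x \in T}.
Proof.
move=> [[[_ Tp] Tab [f [fT fK Kf]]] Tmax].
have [n] := ubnP (\dim A); elim: n A => // n IHn A dimA TA Aab Ap x xA.
have TA' : (T <= p2span A)%VS.
  by apply/subvP => s sT; rewrite -(Kf s sT) mem_p2span // (subvP TA) ?fT.
have A'A := p2span_sub Ap.
have [dimE | ltA] := leqP (\dim A) (\dim (p2span A)).
  exists 0%N; rewrite -(Tmax A) //; apply: torus_p2span => //.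
  by rewrite (_ : p2span A = A) //; apply/eqP; rewrite eqEdim A'A.
have [||||k xk] := IHn (p2span A) _ TA' _ _ (p2map x).
- exact: leq_trans ltA _.
- by move=> y z yA zA; apply: Aab; apply: (subvP A'A).
- by move=> y /(subvP A'A); apply: mem_p2span.
- exact: mem_p2span.
by exists k.+1; rewrite iterSr.
Qed.

Lemma torus_iter_p2map_surj T k x : torus T -> x \in T ->
  exists2 s, s \in T & iter k p2map s = x.
Proof.
case=> _ _ [f [fT _ Kf]]; elim: k x => [|k IHk] x xT; first by exists x.
by have [s sT sx] := IHk _ (fT _ xT); exists s; rewrite //= sx Kf.
Qed.

Lemma torus_iter_p2map_inj0 T k x : torus T -> x \in T ->
  iter k p2map x = 0 -> x = 0.
Proof.
case=> [[_ Tp] _ [f [fT fK _]]] xT; elim: k => //= k IHk xk; apply: IHk.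
have xkT : iter k p2map x \in T by elim: k {xk} => //= k; apply: Tp.
by rewrite -(fK _ xkT) xk -{1}(p2map0 g) fK ?mem0v.
Qed.

(** Some iterated square of [h] lies in [T], where it is the same iterated square of some [s]. Since
    [h] and [s] commute, that iterate kills [h - s]. *)
Lemma jordan_maximal_torus T h : maximal_torus T -> h \in centralizerv T ->
  exists2 s, s \in T & ad_nilpotent (h - s).
Proof.
move=> Tmax /centralizervP hC; have [Tt _] := Tmax.
have [[_ Tp] Tab _] := Tt.
have [|A [UA Aab Ap]] := @abelian_envelope _ g (T + <[h]>)%VS.
  move=> x y /memv_addP[m mT [w /vlineP[a ->] ->]].
  move=> /memv_addP[m' mT' [w' /vlineP[b ->] ->]].
  rewrite lieDl lieZl !linearD !linearZ /= Tab // hC // (lie_swap (hC _ mT')).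
  by rewrite lie_alt !scaler0 !addr0.
have TA := subv_trans (addvSl _ _) UA.
have hA : h \in A by rewrite memvE (subv_trans (addvSr _ _) UA).
have [k hk] := iter_p2map_maximal_torus Tmax TA Aab Ap hA.
have [s sT sh] := torus_iter_p2map_surj k Tt hk.
exists s => //; exists (2 ^ k)%N => y; rewrite iter_p2map_ad oppv_char2.
by rewrite iter_p2mapD ?sh ?addvv_char2 ?lie0l // (lie_swap (hC _ sT)).
Qed.

End Closed.

(** * Two-colourings of the Fano plane *)

Section Fano.

(* Vectors of F_2^3, with [addbv] and [dotbv] the addition and the pairing.   *)
Definition bvec : predArgType := (bool * bool * bool)%type.
Implicit Types (e u v w : bvec).

Definition bvec0 : bvec := (false, false, false).

Definition addbv v w : bvec :=
  (v.1.1 (+) w.1.1, v.1.2 (+) w.1.2, v.2 (+) w.2).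

Definition dotbv v w : bool :=
  (v.1.1 && w.1.1) (+) (v.1.2 && w.1.2) (+) (v.2 && w.2).

Definition bvecs : seq bvec :=
  let bits := [:: false; true] in
  [seq (p, c) | p <- [seq (a, b) | a <- bits, b <- bits],
                c <- bits].

Lemma mem_bvecs v : v \in bvecs.
Proof. by case: v => [[[] []] []]. Qed.

Definition crossing (C : bvec -> bool) e : seq bvec :=
  [seq v <- bvecs | [|| v == bvec0, v == e | C v != C (addbv v e)]].

(* [crossing] contains [e] and is closed under translation by [e]; modulo [e] *)
(* the ambient space is a plane, so sums of two elements exhaust its span.    *)
Definition forced (C : bvec -> bool) e w : bool :=
  has (fun v => has (fun v' => w == addbv v v') (crossing C e)) (crossing C e).

(** A colouring given by its eight values, so that all colourings can be enumerated by case analysis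
    on [c]. *)
Definition table
    (c : bool * bool * bool * bool * bool * bool * bool * bool) v :=
  let: (c0, c1, c2, c3, c4, c5, c6, c7) := c in
  nth false [:: c0; c1; c2; c3; c4; c5; c6; c7] (index v bvecs).

Lemma forced_table c v w : v != bvec0 -> w != bvec0 ->
  table c v != table c w ->
  exists u w' : bvec, [/\ u != bvec0, w' != bvec0 &
    forall e, dotbv e u -> forced (table c) e w'].
Proof.
move=> v0 w0 vw.
pose ok C := has (fun u => has (fun w' => [&& u != bvec0, w' != bvec0 &
    all (fun e => dotbv e u ==> forced C e w') bvecs]) bvecs) bvecs.
suff: ok (table c).
  case/hasP=> u _ /hasP[w' _ /and3P[u0 w'0 /allP uw]].
  by exists u, w'; split=> // e; apply/implyP/uw/mem_bvecs.
pose const (C : bvec -> bool) := all (fun v => all (fun w =>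
  [|| v == bvec0, w == bvec0 | C v == C w]) bvecs) bvecs.
suff: const (table c) || ok (table c).
  case/orP=> // /allP/(_ v (mem_bvecs v))/allP/(_ w (mem_bvecs w)).
  by rewrite (negPf v0) (negPf w0) (negPf vw).
(* All 256 tables are evaluated. The colour of the zero vector is harmless: it could only affect
   whether 0 and [e] are crossing, and both always are. *)
rewrite /const /ok {v w v0 w0 vw}.
by case: c => [[[[[[[[] []] []] []] []] []] []] []]; lazy.
Qed.

(** [Z e v] abstracts [weight_null]. For a nonconstant [C], some nonzero vector is a sum of two
    crossing vectors for every [e] pairing to 1 with some fixed nonzero [u]; additivity of [Z e]
    then contradicts the last hypothesis on [Z]. *)
Lemma fano_constant (C : bvec -> bool) (Z : bvec -> bvec -> Prop) :
  (forall e, Z e bvec0) -> (forall e, Z e e) ->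
  (forall e v w, Z e v -> Z e w -> Z e (addbv v w)) ->
  (forall e v, C v != C (addbv v e) -> Z e v) ->
  (forall u w, u != bvec0 -> w != bvec0 ->
     (forall e, dotbv e u -> Z e w) -> False) ->
  forall v w, v != bvec0 -> w != bvec0 -> C v = C w.
Proof.
move=> Z0 Zself ZD Zcross Znot v w v0 w0; apply/eqP.
have [c Cc] : exists c, C =1 table c.
  pose d k := C (nth bvec0 bvecs k).
  exists (d 0, d 1, d 2, d 3, d 4, d 5, d 6, d 7).
  by case=> [[[] []] []].
apply/negPn/negP; rewrite !Cc => /(forced_table v0 w0)[u [w' [u0 w'0 uw']]].
apply: (Znot u w') => // e /uw' /hasP[x xL /hasP[y yL /eqP->]].
have crossP z : z \in crossing (table c) e -> Z e z.
  rewrite mem_filter => /andP[/or3P[/eqP->|/eqP->|zC] _] //.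
  by apply: Zcross; rewrite !Cc.
by apply: ZD; apply: crossP.
Qed.

End Fano.

(** * Weight spaces *)

(** The center is an ideal. If it were everything, each line would be an ideal as well, which
    dimension above 1 forbids. *)
Lemma lie_simple_center0 (F : fieldType) (g : lieAlgType F) (x : g) :
  lie_simple g -> (1 < \dim {:g})%N -> (forall y, lie x y = 0) -> x = 0.
Proof.
move=> [_ ideals] dim_g xZ.
have Zid : lie_ideal (centralizerv {:g}).
  move=> y z /centralizervP zC; rewrite zC ?memvf //; exact: mem0v.
have xC : x \in centralizerv {:g}.
  by apply/centralizervP => y _; apply: lie_swap.
have [Z0 | Zfull] := ideals _ Zid; first by apply/eqP; rewrite -memv0 -Z0.
have [] := ideals <[x]>%VS.
- move=> y z _; have : z \in centralizerv {:g} by rewrite Zfull memvf.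
  by move=> /centralizervP->; rewrite ?mem0v ?memvf.
- by move=> x0; apply/eqP; rewrite -memv0 -x0 memv_line.
by move=> x1; move: dim_g; rewrite -x1 dim_vline; case: (x != 0).
Qed.

Section Weights.
Variables (F : closedFieldType) (charF2 : 2%N \in [pchar F]).
Variables (g : lie2AlgType F) (t : {vspace g}).
Hypothesis center0 : forall x : g, (forall y, lie x y = 0) -> x = 0.
Hypothesis t_torus : torus t.
Implicit Types (lambda mu : 'Hom(subvs_of t, F^o)) (s : subvs_of t) (x y : g).

Lemma toral_nilpotent0 s : ad_nilpotent (vsval s) -> s = 0.
Proof.
case=> n sn; apply/val_inj => /=.
apply: (@torus_iter_p2map_inj0 _ _ t n) => //; first exact: subvsP.
apply: center0 => y; rewrite -iter_p2map_ad.
(* Iterated squares only give powers of [ad] with exponent [2 ^ n], which is at least [n]. *)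
have [k ->] : exists k, (2 ^ n = k + n)%N.
  by exists (2 ^ n - n)%N; rewrite subnK // ltnW // ltn_expl.
by rewrite iterD sn iter_lie0.
Qed.

Lemma weightP lambda x :
  reflect (forall s, lie (vsval s) x = (lambda s : F) *: x)
    (x \in weightv lambda).
Proof. by apply: (iffP idP) => /mem_weightv. Qed.

Lemma lie_weight lambda mu x y : x \in weightv lambda -> y \in weightv mu ->
  lie x y \in weightv (lambda + mu).
Proof.
move=> /weightP xl /weightP ym; apply/weightP => s.
by rewrite lie_leibniz xl ym lieZl linearZ /= -scalerDl add_lfunE.
Qed.

Lemma p2map_weight lambda x :
  x \in weightv lambda -> p2map x \in centralizerv t.
Proof.
move=> /weightP xl; apply/centralizervP => u ut; apply: lie_swap.
rewrite -p2map_ad (lieC x u) (xl (Subvs ut)) linearN linearZ /= lie_alt.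
by rewrite scaler0 oppr0.
Qed.

(* For triangulable c(t) = t + n this says that [mu] vanishes on the toral    *)
(* parts of the squares of all elements of weight [lambda].                   *)
Definition weight_null lambda mu := forall x s,
  x \in weightv lambda -> ad_nilpotent (p2map x - vsval s) -> (mu s : F) = 0.

Lemma weight_null0 lambda : weight_null lambda 0.
Proof. by move=> x s _ _; rewrite zero_lfunE. Qed.

Lemma weight_nullD lambda mu nu :
  weight_null lambda mu -> weight_null lambda nu ->
  weight_null lambda (mu + nu).
Proof. by move=> m n x s xl xs; rewrite add_lfunE (m x) ?(n x) ?addr0. Qed.

(** The square of [x] kills [x], so [x] is an eigenvector of the ad-nilpotent [p2map x - s] with
    eigenvalue [- lambda s]. *)
Lemma weight_null_self lambda : weight_null lambda lambda.
Proof.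
move=> x s xl xs; have [x0 | x0] := eqVneq x 0.
  rewrite (_ : s = 0) ?linear0 //; apply: toral_nilpotent0.
  rewrite -[vsval s]opprK -scaleN1r; apply: ad_nilpotentZ.
  by move: xs; rewrite x0 p2map0 add0r.
apply/eqP; rewrite -oppr_eq0; apply/eqP.
apply: ad_nilpotent_eigenvalue xs _ x0.
rewrite lieDl -p2map_ad lie_alt lie0r add0r -scaleN1r lieZl.
by rewrite (weightP _ _ xl) scalerA mulN1r.
Qed.

(** [ad x] is injective on the weight space of [mu]: a vector in its kernel would be an eigenvector
    of an ad-nilpotent element with eigenvalue [- mu s]. *)
Lemma dim_weight_le lambda mu x s :
  x \in weightv lambda -> ad_nilpotent (p2map x - vsval s) -> (mu s : F) != 0 ->
  (\dim (weightv mu) <= \dim (weightv (mu + lambda)%R))%N.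
Proof.
move=> xl xs mus.
have /limg_dim_eq <- : (weightv mu :&: lker (ad x) = 0)%VS.
  apply/eqP; rewrite -subv0; apply/subvP => v /memv_capP[vmu].
  rewrite memv_ker adE memv0 => /eqP xv; apply/negPn/negP => v0.
  case/negP: mus; rewrite -oppr_eq0; apply/eqP.
  apply: ad_nilpotent_eigenvalue xs _ v0.
  rewrite lieDl -p2map_ad xv lie0r add0r -scaleN1r lieZl.
  by rewrite (weightP _ _ vmu) scalerA mulN1r.
apply: dimvS; apply/subvP => _ /memv_imgP[v vmu ->].
by rewrite adE addrC lie_weight.
Qed.

(** If [mu s] is nonzero, so is [(mu + lambda) s], and [dim_weight_le] applies in both directions
    because [lambda + lambda = 0]. *)
Lemma weight_null_dim lambda mu :
  \dim (weightv mu) != \dim (weightv (mu + lambda)) -> weight_null lambda mu.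
Proof.
move=> dimN x s xl xs; apply/eqP; apply: contraNT dimN => mus.
rewrite eqn_leq (dim_weight_le xl xs) //=.
have mus' : ((mu + lambda) s : F) != 0.
  by rewrite add_lfunE (weight_null_self xl xs) addr0.
have := dim_weight_le xl xs mus'; rewrite -addrA.
suff -> : lambda + lambda = 0 by rewrite addr0.
apply/lfunP => u; rewrite add_lfunE zero_lfunE.
by rewrite -[X in X + _](oppr_pchar2 charF2) addNr.
Qed.

End Weights.

Lemma span_ind (F : fieldType) (V : vectType F) (X : seq V) (P : V -> Prop) :
  P 0 -> (forall x y, P x -> P y -> P (x + y)) ->
  (forall a x, P x -> P (a *: x)) -> (forall x, x \in X -> P x) ->
  forall x, x \in <<X>>%VS -> P x.
Proof.
move=> P0 PD PZ; elim: X => [|y X IHX] PX x.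
  by rewrite span_nil memv0 => /eqP->.
rewrite span_cons => /memv_addP[_ /vlineP[a ->] [z zX ->]].
apply: PD; first by apply/PZ/PX/mem_head.
by apply: IHX zX => w wX; apply: PX; rewrite inE wX orbT.
Qed.

(** * Eigenprojections of toral elements *)

Section Eigenproj.
Variables (F : fieldType) (g : lieAlgType F).
Implicit Types (b : bool) (u v x y : g).

(** When [ad u] is idempotent, these are the projections onto its eigenspaces for 1 and 0. *)
Definition eigenproj b u : 'End(g) := if b then ad u else (\1 - ad u)%VF.

Lemma eigenprojE b u x : eigenproj b u x = if b then lie u x else x - lie u x.
Proof.
by case: b; rewrite /eigenproj ?add_lfunE ?opp_lfunE ?id_lfunE adE.
Qed.

Lemma eigenproj_split u x : x = eigenproj true u x + eigenproj false u x.
Proof. by rewrite !eigenprojE addrC subrK. Qed.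

Lemma eigenproj_eigen b u x : lie u (lie u x) = lie u x ->
  lie u (eigenproj b u x) = b%:R *: eigenproj b u x.
Proof.
rewrite !eigenprojE => uu; case: b; first by rewrite uu scale1r.
by rewrite linearB /= uu subrr scale0r.
Qed.

Lemma eigenproj_comm b u v x a : lie v u = 0 -> lie v x = a *: x ->
  lie v (eigenproj b u x) = a *: eigenproj b u x.
Proof.
move=> vu vx; have vux : lie v (lie u x) = a *: lie u x.
  by rewrite lie_leibniz vu lie0l add0r vx linearZ.
by rewrite !eigenprojE; case: b; rewrite ?linearB /= vux ?vx ?scalerBr.
Qed.

Lemma eigenproj0_eigen u x b : lie u x = b%:R *: x ->
  eigenproj false u x = (~~ b)%:R *: x.
Proof.
rewrite !eigenprojE => ->.
by case: b; rewrite ?scale1r ?scale0r ?subrr ?subr0.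
Qed.

End Eigenproj.

(** * Weights over F_2 and the ideal generated by a toral element *)

Section ToralBasis.
Variables (F : closedFieldType) (charF2 : 2%N \in [pchar F]).
Variables (g : lie2AlgType F) (t : {vspace g}).
Hypothesis g_simple : lie_simple g.
Hypothesis center0 : forall x : g, (forall y, lie x y = 0) -> x = 0.
Hypothesis t_max : maximal_torus t.
Hypothesis h_triang : triangulable (centralizerv t).
Variables t1 t2 t3 : subvs_of t.
Hypothesis t_basis : basis_of {:subvs_of t} [:: t1; t2; t3].
Hypothesis t1_toral : toral (vsval t1).
Hypothesis t2_toral : toral (vsval t2).
Hypothesis t3_toral : toral (vsval t3).
Variables alpha beta gamma : 'Hom(subvs_of t, F^o).
Hypothesis t_dual : dual_basis [tuple t1; t2; t3] [tuple alpha; beta; gamma].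
Implicit Types (x y z : g) (s : subvs_of t) (e u v w : bvec).

Definition weight_of v : 'Hom(subvs_of t, F^o) :=
  v.1.1%:R *: alpha + v.1.2%:R *: beta + v.2%:R *: gamma.

Let t_torus : torus t := proj1 t_max.

Lemma torus_lie s s' : lie (vsval s) (vsval s') = 0.
Proof. by have [_ tab _] := t_torus; rewrite tab ?subvsP. Qed.

Lemma torus_coords s : exists a b c, s = a *: t1 + b *: t2 + c *: t3.
Proof.
have : s \in <<[:: t1; t2; t3]>>%VS by rewrite (span_basis t_basis) memvf.
rewrite !span_cons span_nil addv0.
case/memv_addP=> _ /vlineP[a ->] [z /memv_addP[_ /vlineP[b ->]]].
by case=> _ /vlineP[c ->] -> ->; exists a, b, c; rewrite addrA.
Qed.

Lemma weight_ofE v a b c :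
  weight_of v (a *: t1 + b *: t2 + c *: t3) =
    v.1.1%:R * a + v.1.2%:R * b + v.2%:R * c :> F.
Proof.
have dual (i j : nat) (i3 : (i < 3)%N) (j3 : (j < 3)%N) :=
  t_dual (Ordinal i3) (Ordinal j3).
rewrite /weight_of !add_lfunE !scale_lfunE !linearD !linearZ /=.
have := (dual 0%N 0%N isT isT, dual 0%N 1%N isT isT, dual 0%N 2%N isT isT).
rewrite !(tnth_nth 0) /= => -[[-> ->] ->].
have := (dual 1%N 0%N isT isT, dual 1%N 1%N isT isT, dual 1%N 2%N isT isT).
rewrite !(tnth_nth 0) /= => -[[-> ->] ->].
have := (dual 2%N 0%N isT isT, dual 2%N 1%N isT isT, dual 2%N 2%N isT isT).
rewrite !(tnth_nth 0) /= => -[[-> ->] ->].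
have scE (k x : F) : k *: (x : F^o) = k * x by [].
by rewrite !scaler0 !addr0 !add0r !scE !mulr1 ![_ * v.1.1%:R]mulrC
  [b * _]mulrC [c * _]mulrC.
Qed.

Lemma weight_of_basis v : [/\ weight_of v t1 = v.1.1%:R :> F,
  weight_of v t2 = v.1.2%:R :> F & weight_of v t3 = v.2%:R :> F].
Proof.
have E := weight_ofE v; split.
- by have := E 1 0 0; rewrite scale1r !scale0r !addr0 mulr1 !mulr0 !addr0.
- have := E 0 1 0.
  by rewrite scale1r !scale0r addr0 add0r mulr1 !mulr0 addr0 add0r.
- by have := E 0 0 1; rewrite scale1r !scale0r !add0r mulr1 !mulr0 !add0r.
Qed.

Lemma mem_weight_of v x : lie (vsval t1) x = v.1.1%:R *: x ->
  lie (vsval t2) x = v.1.2%:R *: x -> lie (vsval t3) x = v.2%:R *: x ->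
  x \in weightv (weight_of v).
Proof.
move=> x1 x2 x3; apply/weightP => s; have [a [b [c ->]]] := torus_coords s.
rewrite weight_ofE !linearD !linearZ /= !lieDl !lieZl x1 x2 x3 !scalerA.
by rewrite -!scalerDl ![_ * _%:R]mulrC.
Qed.

Lemma natr_addb (a b : bool) : (a (+) b)%:R = a%:R + b%:R :> F.
Proof.
case: a b => [] []; rewrite ?addr0 ?add0r //.
by rewrite -mulrSr (pcharf0 charF2).
Qed.

Lemma weight_of_addbv v w : weight_of (addbv v w) = weight_of v + weight_of w.
Proof.
by rewrite /weight_of !natr_addb !scalerDl [X in X + _]addrACA [LHS]addrACA.
Qed.

Lemma weight_of0 : weight_of bvec0 = 0.
Proof. by rewrite /weight_of !scale0r !addr0. Qed.

Lemma toral_idem y x : toral y -> lie y (lie y x) = lie y x.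
Proof. by move=> yt; rewrite p2map_ad yt. Qed.

Lemma weight_ind (P : g -> Prop) : (forall x y, P x -> P y -> P (x + y)) ->
  (forall v x, x \in weightv (weight_of v) -> P x) -> forall x, P x.
Proof.
move=> PD Pw x; rewrite (eigenproj_split (vsval t1) x).
suff P1 a : P (eigenproj a (vsval t1) x) by apply: PD.
set x1 := eigenproj _ _ _; rewrite (eigenproj_split (vsval t2) x1).
suff P2 b : P (eigenproj b (vsval t2) x1) by apply: PD.
set x2 := eigenproj _ _ _; rewrite (eigenproj_split (vsval t3) x2).
suff P3 c : P (eigenproj c (vsval t3) x2) by apply: PD.
have x1E : lie (vsval t1) x1 = a%:R *: x1.
  by rewrite eigenproj_eigen // toral_idem.
have x2E : lie (vsval t2) x2 = b%:R *: x2.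
  by rewrite eigenproj_eigen // toral_idem.
apply: (Pw (a, b, c)); apply: mem_weight_of => /=.
- by do 2?[apply: eigenproj_comm; first exact: torus_lie].
- by apply: eigenproj_comm; first exact: torus_lie.
by rewrite eigenproj_eigen // toral_idem.
Qed.

(** The projection onto the weight space of 0, which is the centralizer of [t]. *)
Definition proj0 x : g :=
  eigenproj false (vsval t1)
  (eigenproj false (vsval t2) (eigenproj false (vsval t3) x)).

Lemma proj0D x y : proj0 (x + y) = proj0 x + proj0 y.
Proof. by rewrite /proj0 !linearD. Qed.

Lemma proj0Z a x : proj0 (a *: x) = a *: proj0 x.
Proof. by rewrite /proj0 !linearZ. Qed.

Lemma proj0_weight v x : x \in weightv (weight_of v) ->
  proj0 x = (v == bvec0)%:R *: x.
Proof.
move=> /weightP xv; have [v1 v2 v3] := weight_of_basis v.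
have := (xv t1, xv t2, xv t3); rewrite v1 v2 v3 => -[[x1 x2] x3].
rewrite /proj0 (eigenproj0_eigen x3) !linearZ /= (eigenproj0_eigen x2).
rewrite !linearZ /= (eigenproj0_eigen x1) !scalerA; congr (_ *: _).
by case: v {xv v1 v2 v3 x1 x2 x3} => [[[] []] []]; rewrite ?mulr0 ?mul0r ?mulr1.
Qed.

(** In the decomposition of the centralizer as [t] plus nilpotents, this is the kernel of
    [weight_of w] plus the nilpotents. *)
Definition null_part w x := x \in centralizerv t /\
  exists2 s, (weight_of w s : F) = 0 & ad_nilpotent (x - vsval s).

Lemma null_partD w x y : null_part w x -> null_part w y -> null_part w (x + y).
Proof.
move=> [xC [s sw xs]] [yC [s' s'w ys]]; split; first exact: rpredD.
have sC (s0 : subvs_of t) : vsval s0 \in centralizerv t.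
  by apply/centralizervP => u ut; apply: (torus_lie (Subvs ut)).
exists (s + s'); first by rewrite linearD /= sw s'w addr0.
rewrite (linearD vsval s s') opprD addrACA.
apply: (triangulable_nilpotentD (@centralizer_subalgebra _ _ t) h_triang) => //.
- by rewrite rpredB ?sC.
- by rewrite rpredB ?sC.
Qed.

Lemma null_partZ w a x : null_part w x -> null_part w (a *: x).
Proof.
move=> [xC [s sw xs]]; split; first exact: rpredZ.
exists (a *: s); first by rewrite linearZ /= sw scaler0.
by rewrite (linearZ_LR vsval a s) -scalerBr; apply: ad_nilpotentZ.
Qed.

Lemma null_part0 w : null_part w 0.
Proof.
split; first exact: mem0v.
exists 0; first by rewrite linear0.
by rewrite (linear0 vsval) subr0; exists 1%N => y /=; rewrite lie0l.
Qed.

Lemma null_part_p2map e w x : weight_null (weight_of e) (weight_of w) ->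
  x \in weightv (weight_of e) -> null_part w (p2map x).
Proof.
move=> ew xe; have xC := p2map_weight xe; split=> //.
have [s st xs] := jordan_maximal_torus charF2 t_max xC.
by exists (Subvs st) => //; apply: (ew x).
Qed.

Definition toral_of u : g :=
  vsval (u.1.1%:R *: t1 + u.1.2%:R *: t2 + u.2%:R *: t3).

Lemma toral_of_weight e u x : x \in weightv (weight_of e) ->
  lie (toral_of u) x = (dotbv e u)%:R *: x.
Proof.
move=> /weightP->; rewrite weight_ofE /dotbv !natr_addb.
by rewrite -!natrM !mulnb.
Qed.

Lemma toral_of_idem u x :
  lie (toral_of u) (lie (toral_of u) x) = lie (toral_of u) x.
Proof.
move: x; apply: weight_ind => [x y xu yu | e x xe].
  by rewrite !linearD /= xu yu.
rewrite (toral_of_weight u xe) linearZ /= (toral_of_weight u xe).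
by case: dotbv; rewrite ?scale1r ?scale0r.
Qed.

(** In characteristic 2, [ad (toral_of u)] grades the algebra by F_2, its image being the odd part.
    The odd part plus its brackets is stable under both even and odd elements. *)
Lemma ideal_toral_of u :
  lie_ideal (limg (ad (toral_of u)) + derivedv (limg (ad (toral_of u))))%VS.
Proof.
set U := toral_of u; set I1 := limg _; set I := (_ + _)%VS.
have I1P x : reflect (lie U x = x) (x \in I1).
  apply: (iffP idP) => [/memv_imgP[y _ ->] | xU].
    by rewrite adE toral_of_idem.
  by apply/memv_imgP; exists x; rewrite ?memvf ?adE.
have I1I : (I1 <= I)%VS by apply: addvSl.
have I2I : (derivedv I1 <= I)%VS by apply: addvSr.
have I2U : {in derivedv I1, forall z, lie U z = 0}.
  apply: (span_ind (P := fun z => lie U z = 0)).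
  - exact: lie0r.
  - by move=> x y xU yU; rewrite linearD /= xU yU addr0.
  - by move=> a x xU; rewrite linearZ /= xU scaler0.
  move=> _ /allpairsP[[x y] /= [xI yI ->]].
  rewrite lie_leibniz (I1P _ (vbasis_mem xI)) (I1P _ (vbasis_mem yI)).
  exact: addvv_char2.
have y0I1 y0 z : lie U y0 = 0 -> z \in I1 -> lie y0 z \in I1.
  by move=> y0U /I1P zU; apply/I1P; rewrite lie_leibniz y0U lie0l add0r zU.
move=> y z /memv_addP[z1 z1I [z2 z2I ->]].
rewrite -[y](subrK (lie U y)); set y0 := y - _; set y1 := lie U y.
have y0U : lie U y0 = 0 by rewrite linearB /= toral_of_idem subrr.
have y1I : y1 \in I1 by apply/I1P/toral_of_idem.
rewrite lieDl !linearD /=. rewrite !rpredD //.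
- exact: subvP I1I _ (y0I1 _ _ y0U z1I).
- apply: (subvP I2I); move: z2 z2I.
  apply: (span_ind (P := fun z => lie y0 z \in derivedv I1)).
  + by rewrite lie0r mem0v.
  + by move=> a b aI bI; rewrite linearD rpredD.
  + by move=> k a aI; rewrite linearZ rpredZ.
  move=> _ /allpairsP[[a b] /= [/vbasis_mem aI /vbasis_mem bI ->]].
  by rewrite lie_leibniz rpredD ?mem_derivedv ?y0I1.
- by apply: (subvP I2I); apply: mem_derivedv.
apply: (subvP I1I); rewrite lieC rpredN; apply: y0I1 => //; exact: I2U.
Qed.

Lemma toral_of_eq0 u : toral_of u = 0 -> u = bvec0.
Proof.
move=> u0; have tu0 : u.1.1%:R *: t1 + u.1.2%:R *: t2 + u.2%:R *: t3 = 0.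
  exact/val_inj.
have E e : (dotbv e u)%:R = 0 :> F.
  have := weight_ofE e u.1.1%:R u.1.2%:R u.2%:R; rewrite tu0 linear0.
  by rewrite -!natrM !mulnb /dotbv !natr_addb => <-.
have {}E e : dotbv e u = false.
  by have := E e; case: dotbv => // /eqP; rewrite oner_eq0.
have := (E (true, false, false), E (false, true, false),
  E (false, false, true)).
by case: u {u0 tu0 E} => [[[] []] []] [[]].
Qed.

(** By simplicity the ideal of [ideal_toral_of] is everything. Its weight 0 component comes only
    from brackets of odd elements, which would all lie in [null_part w]; then [weight_of w] would
    vanish on [t]. *)
Lemma not_all_weight_null u w : u != bvec0 -> w != bvec0 ->
  (forall e, dotbv e u -> weight_null (weight_of e) (weight_of w)) -> False.
Proof.
move=> u0 w0 ew; set U := toral_of u; set I1 := limg (ad U).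
have Ifull : (I1 + derivedv I1)%VS = fullv.
  have [_ ideals] := g_simple; have [I0|//] := ideals _ (@ideal_toral_of u).
  case/eqP: u0; apply: toral_of_eq0; apply: center0 => y.
  apply/eqP; rewrite -memv0 -I0; apply: subvP (addvSl _ _) _ _.
  by rewrite -adE memv_img ?memvf.
have proj_lie y : proj0 (lie U y) = 0.
  move: y; apply: weight_ind => [x y xu yu | e x xe].
    by rewrite linearD /= proj0D xu yu addr0.
  rewrite (toral_of_weight u xe) proj0Z (proj0_weight xe) scalerA.
  have [-> | _] := eqVneq e bvec0; last by rewrite mulr0 scale0r.
  by rewrite mul0r scale0r.
have null_lie x y : null_part w (proj0 (lie (lie U x) (lie U y))).
  move: x; apply: weight_ind => [x x' xn xn' | e x xe].
    by rewrite linearD /= lieDl proj0D; apply: null_partD.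
  move: y; apply: weight_ind => [y y' yn yn' | e' y ye].
    by rewrite !linearD /= proj0D; apply: null_partD.
  rewrite (toral_of_weight u xe) (toral_of_weight u ye) lieZl linearZ /=.
  rewrite !proj0Z.
  have xye : lie x y \in weightv (weight_of (addbv e e')).
    by rewrite weight_of_addbv lie_weight.
  rewrite (proj0_weight xye).
  (* Only weights with sum 0 reach weight 0, and over F_2 this means [e' = e]. *)
  have [ee' | _] := eqVneq (addbv e e') bvec0; last first.
    by rewrite scale0r !scaler0; apply: null_part0.
  have ee : e' = e.
    by move: ee'; case: e {xe xye} => [[[] []] []];
      case: e' {ye} => [[[] []] []].
  rewrite {}ee {e' ee' xye} in ye *; rewrite scale1r.
  have [eu | _] := boolP (dotbv e u); last first.
    by rewrite !scale0r; apply: null_part0.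
  (* Polarization: the bracket is [p2map (x + y)] minus the two squares, all squares of elements of
     weight [e]. *)
  do 2!apply: null_partZ; rewrite -[lie x y](addKr (p2map x + p2map y)) -p2mapD.
  have sq := null_part_p2map (ew e eu).
  rewrite oppv_char2 //; apply: null_partD; last by apply: sq; rewrite rpredD.
  by apply: null_partD; apply: sq.
have null_all y : null_part w (proj0 y).
  have : y \in (I1 + derivedv I1)%VS by rewrite Ifull memvf.
  case/memv_addP=> _ /memv_imgP[y1 _ ->] [y2 y2I ->] {y}.
  rewrite proj0D adE proj_lie add0r; move: y2 y2I.
  apply: (span_ind (P := fun y => null_part w (proj0 y))).
  - by rewrite -(scale0r 0) proj0Z scale0r; apply: null_part0.
  - by move=> x y xn yn; rewrite proj0D; apply: null_partD.
  - by move=> a x xn; rewrite proj0Z; apply: null_partZ.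
  move=> _ /allpairsP[[a b] /= [/vbasis_mem aI /vbasis_mem bI ->]].
  by case/memv_imgP: aI => a' _ ->; case/memv_imgP: bI => b' _ ->; rewrite !adE.
have null_t s : (weight_of w s : F) = 0.
  have s0 : vsval s \in weightv (weight_of bvec0).
    rewrite weight_of0; apply/weightP => s'.
    by rewrite torus_lie zero_lfunE scale0r.
  (* The difference of [s] and [s'] is an ad-nilpotent element of the torus, hence 0. *)
  have [_ [s' ws' ss']] := null_all (vsval s).
  suff /subr0_eq-> : s - s' = 0 by [].
  apply: (toral_nilpotent0 center0 t_torus).
  by rewrite linearB; move: ss'; rewrite (proj0_weight s0) eqxx scale1r.
have bit0 (b : bool) : 0 = b%:R :> F -> b = false.
  by case: b => // /eqP; rewrite eq_sym oner_eq0.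
have [] := weight_of_basis w; rewrite !null_t => /bit0 w1 /bit0 w2 /bit0 w3.
case/eqP: w0.
by case: w w1 w2 w3 {ew null_lie null_all null_t} => [[a b] c] /= -> -> ->.
Qed.

(** The colour of a weight records whether its space has the dimension of that of [w], so a change
    of colour is a change of dimension. *)
Lemma dim_weight_of v w : v != bvec0 -> w != bvec0 ->
  \dim (weightv (weight_of v)) = \dim (weightv (weight_of w)).
Proof.
move=> v0 w0; apply/eqP.
pose C (x : bvec) :=
  \dim (weightv (weight_of x)) == \dim (weightv (weight_of w)).
pose Z (x y : bvec) := weight_null (weight_of x) (weight_of y).
suff : C v = C w by rewrite /C eqxx.
apply: (@fano_constant C Z) => //.
- by move=> e; rewrite /Z weight_of0; apply: weight_null0.
- by move=> e; apply: weight_null_self.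
- by move=> e e' e''; rewrite /Z weight_of_addbv; apply: weight_nullD.
- move=> e e' Cx; apply: weight_null_dim => //; rewrite -weight_of_addbv.
  by apply: contraNneq Cx => dimE; rewrite /C dimE.
exact: not_all_weight_null.
Qed.

End ToralBasis.

Theorem theorem3p5 (F : closedFieldType) (charF2 : 2%N \in [pchar F])
    (g : lie2AlgType F)
    (g_simple : lie_simple g)
    (MTg : toral_rank_spec g 3)
    (t : {vspace g})
    (t_max : maximal_torus t)
    (dim_t : \dim t = 3%N)
    (h_triang : triangulable (centralizerv t))
    (t1 t2 t3 : subvs_of t)
    (t_basis : basis_of {:subvs_of t} [:: t1; t2; t3])
    (t1_toral : toral (vsval t1))
    (t2_toral : toral (vsval t2))
    (t3_toral : toral (vsval t3))
    (alpha beta gamma : 'Hom(subvs_of t, F^o))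
    (t_dual : dual_basis [tuple t1; t2; t3] [tuple alpha; beta; gamma])
    (xi sigma : 'Hom(subvs_of t, F^o))
    (xi_in : xi \in [:: alpha; beta; gamma; alpha + beta; alpha + gamma;
                        beta + gamma; alpha + beta + gamma])
    (sigma_in : sigma \in [:: alpha; beta; gamma; alpha + beta; alpha + gamma;
                              beta + gamma; alpha + beta + gamma]) :
  \dim (weightv xi) = \dim (weightv sigma).
Proof.
have center0 (x : g) : (forall y, lie x y = 0) -> x = 0.
  apply: lie_simple_center0 g_simple _; apply: leq_trans (dimvS (subvf t)).
  by rewrite dim_t.
have weight_ofP rho : rho \in [:: alpha; beta; gamma; alpha + beta;
    alpha + gamma; beta + gamma; alpha + beta + gamma] ->
    exists2 v, v != bvec0 & rho = weight_of alpha beta gamma v.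
  pose sE := (@scale0r, @scale1r, @add0r, @addr0).
  rewrite !inE => /or4P[||| /or4P[]] /eqP->.
  - by exists (true, false, false); rewrite /weight_of /= ?sE.
  - by exists (false, true, false); rewrite /weight_of /= ?sE.
  - by exists (false, false, true); rewrite /weight_of /= ?sE.
  - by exists (true, true, false); rewrite /weight_of /= ?sE.
  - by exists (true, false, true); rewrite /weight_of /= ?sE.
  - by exists (false, true, true); rewrite /weight_of /= ?sE.
  by exists (true, true, true); rewrite /weight_of /= ?sE.
have [v v0 ->] := weight_ofP xi xi_in.
have [w w0 ->] := weight_ofP sigma sigma_in.
exact: (dim_weight_of charF2 g_simple center0 t_max h_triang t_basis
  t1_toral t2_toral t3_toral t_dual).
Qed.
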